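(* For every $n\ge1$, the number of steady paths of size $n$ is equal to the number of permutations in $AV_n(1\text{-}23\text{-}4)$, and thus is the $n$-th powered Catalan number $p_n$.
   Context: A steady path of size $n$ is a lattice path $P$ confined to the cone $\mathfrak{C}=\{(x,y)\in\mathbb{N}^2: y\le x\}$, using steps $U=(1,1)$, $D=(1,-1)$ and $W=(-1,1)$, without any factor (pair of consecutive steps) $WD$ or $DW$, starting at $(0,0)$ and ending at $(2n,0)$, such that: (S1) for any factor $UU$, the suffix of $P$ following this $UU$ factor lies weakly below the line parallel to $y=x$ passing through the $UU$ factor; (S2) for any factor $WU$, the suffix of $P$ following this $WU$ factor lies weakly below the line parallel to $y=x$ passing through the up step $U$ of the $WU$ factor. $AV_n(1\text{-}23\text{-}4)$ is the set of permutations $\pi=\pi_1\cdots\pi_n$ of $\{1,\ldots,n\}$ for which there are no indices $j<i$ and $k>i+1$ with $\pi_j<\pi_i<\pi_{i+1}<\pi_k$. The powered Catalan numbers are $p_n=\sum_{k=0}^n c_{n,k}$, where $c_{0,0}=1$, $c_{n,0}=0$ for $n\ge1$, and $c_{n,k}=c_{n-1,k-1}+k\sum_{j=k}^{n-1}c_{n-1,j}$ for $n\ge1$ and $1\le k\le n$. *)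

(* Defs.v *)
From mathcomp Require Import all_boot all_order all_algebra.
From mathcomp Require Import all_fingroup all_classical.

Set Implicit Arguments.
Unset Strict Implicit.
Unset Printing Implicit Defensive.

Import Order.TTheory GRing.Theory Num.Theory.

Local Open Scope ring_scope.

(* A point of the plane lattice, or the displacement of a step. *)
Definition point := (int * int)%type.

Definition stepU : point := (1, 1).
Definition stepD : point := (1, -1).
Definition stepW : point := (-1, 1).

(* A path starts at the origin and is given by its sequence of steps. *)
Definition endpoint (P : seq point) : point := \sum_(s <- P) s.

Definition in_cone (v : point) : Prop :=
  [/\ 0 <= v.1, 0 <= v.2 & v.2 <= v.1].

(* [v] is weakly below the line of slope 1 through [p]. *)
Definition weakly_below (p v : point) : Prop := v.2 <= v.1 + (p.2 - p.1).

(* Steps are segments and both the cone and the half-planes are convex, so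
   it is enough to constrain the vertices of the path. *)
Record steady_path (n : nat) (P : seq point) : Prop := SteadyPath {
  steady_steps : all [in [:: stepU; stepD; stepW]] P;
  steady_cone : forall k : nat, in_cone (endpoint (take k P));
  steady_noWD : ~~ infix [:: stepW; stepD] P;
  steady_noDW : ~~ infix [:: stepD; stepW] P;
  steady_end : endpoint P = ((2 * n)%:Z, 0);
  steady_UU : forall A B : seq point, P = A ++ [:: stepU; stepU] ++ B ->
    forall k : nat, weakly_below (endpoint A)
      (endpoint (A ++ [:: stepU; stepU] ++ take k B));
  steady_WU : forall A B : seq point, P = A ++ [:: stepW; stepU] ++ B ->
    forall k : nat, weakly_below (endpoint (A ++ [:: stepW]))
      (endpoint (A ++ [:: stepW; stepU] ++ take k B)) }.

(* Permutations of {0, ..., n-1}; [i'] is the index following [i]. *)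
Definition AV_1_23_4 (n : nat) : {set 'S_n} :=
  [set s : 'S_n | ~~ [exists j : 'I_n, exists i : 'I_n, exists i' : 'I_n,
     exists k : 'I_n,
     [&& (j < i)%N, i' == i.+1 :> nat, (i' < k)%N,
         (s j < s i)%N, (s i < s i')%N & (s i' < s k)%N]]].

(* The recurrence is only meant for k <= n; it yields 0 when k > n. *)
Fixpoint pcat_coef (n k : nat) : nat :=
  match n, k with
  | 0, 0 => 1
  | 0, _.+1 => 0
  | _.+1, 0 => 0
  | m.+1, l.+1 => pcat_coef m l + k * \sum_(k <= j < n) pcat_coef m j
  end%N.

Definition powered_catalan (n : nat) : nat :=
  (\sum_(0 <= k < n.+1) pcat_coef n k)%N.

(* Main.v *)
Require Import Defs.
From mathcomp Require Import all_boot all_order all_algebra.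
From mathcomp Require Import all_fingroup all_classical.
From mathcomp Require Import finmap zify.

Set Implicit Arguments.
Unset Strict Implicit.
Unset Printing Implicit Defensive.

(** Steady paths and permutations avoiding 1-23-4 grow along the same
    generating tree, and the size of a level of that tree is computed by an
    array of recurrences whose solution is a Stirling transform of the powered
    Catalan triangle.

    The tree. Its nodes are pairs (M, c); the children of (M, c) are (M + 1, a)
    for 1 <= a <= c and (a, a) for c < a <= M + 1; its root is (1, 1).

    Permutations. Delete the last value of a permutation. A value a may be
    appended exactly when it does not exceed the smallest value that plays the
    role of 3 in an occurrence of 1-23; let M be this bound and l the last
    value, counted from 0. Appending a <= l leaves the 1-23 occurrences alone
    and shifts the bound to M + 1; appending a > l creates an occurrence that
    makes a the new bound, unless l = 0, where nothing lies below l.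
    Permutations with l = 0 therefore grow like those with l = M. Recording
    l = 0 as l = M turns this rule into that of the tree, the appended value 0
    giving the child labelled M + 1 (sum_perm_state).

    Steady paths. A path with u steps U and drift d (the number of steps D minus
    the number of steps W) ends at (u + d, u - d). The cone condition becomes
    0 <= d <= u, and both (S1) and (S2) say that the drift never goes below its
    value at a factor UU or WU. Since WD and DW are excluded, what separates two
    consecutive steps U is a run of equal steps, so the path is the sequence of
    the drifts at its steps U. After p steps U, with current drift d and lower
    bound L, the next drift b is any value in [L, p], and L becomes b exactly
    when b <= d; in the coordinates (p - L, p - d) this is again the rule of the
    tree (size_steady_suffixes).

    Counting. Let V p m c be the number of nodes (M, d) of level p with m <= M
    and c <= d. Counting children gives a Pascal rule off the diagonal m = c and
    a second rule on it. By the Pascal rule, the values on a line p - m = const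
    are binomial transforms of the diagonal values D b q =
    V (b + q) (q + 1) (q + 1).
    As binomial transforms act on Stirling numbers of the second kind by a shift
    (stirling_binomial), the solution is
      D b q = \sum_k S(q, k) t_(b+1+k, k+1),
    where t_(n, k) = \sum_(j >= k) c_(n, j); substituted into the recurrences,
    it turns them into the recurrence of the c_(n, k). At q = 0 the left-hand
    side is the size of level b and the right-hand side is
    t_(b+1, 1) = p_(b+1). *)

(** * A generating tree and its levels *)

Definition child (x : nat * nat) (a : nat) : nat * nat :=
  (if a <= x.2 then x.1.+1 else a, a).

Definition children (x : nat * nat) : seq (nat * nat) :=
  [seq child x a | a <- iota 1 x.1.+1].

Definition next_generation (l : seq (nat * nat)) := flatten (map children l).

Definition generation (r : nat) (l : seq (nat * nat)) :=
  iter r next_generation l.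

Definition level (p : nat) := generation p [:: (1, 1)].

Lemma sum_next_generation (F : nat * nat -> nat) l :
  \sum_(y <- next_generation l) F y = \sum_(x <- l) \sum_(y <- children x) F y.
Proof. by rewrite big_flatten big_map. Qed.

(** Levels are built from the root downwards, while suffixes of paths are
    enumerated from a node onwards; this additivity reconciles the two. *)
Lemma size_generation r l :
  size (generation r l) = \sum_(x <- l) size (generation r [:: x]).
Proof.
elim: r l => [|r IHr] l; first by rewrite /= sum1_size.
rewrite /generation iterSr -/(generation _ _) IHr sum_next_generation.
apply: eq_bigr => x _; rewrite /generation iterSr -/(generation _ _) IHr.
by rewrite /next_generation /= cats0.
Qed.

Lemma level_bounds p x : x \in level p -> 1 <= x.2 <= x.1.
Proof.
elim: p x => [|p IHp] x; first by rewrite inE => /eqP->.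
move=> /flattenP[_ /mapP[[M d] /IHp /= dM ->]] /mapP[a].
by rewrite mem_iota => ? -> /=; case: (leqP a d); lia.
Qed.

(** * Counting the nodes of a level *)

Definition quadrant_count (p m c : nat) : nat :=
  count [pred x | (m <= x.1) && (c <= x.2)] (level p).

Lemma count_level (a : pred (nat * nat)) p :
  count a (level p.+1) = \sum_(x <- level p) count a (children x).
Proof.
rewrite -sum1_count (big_mkcond a) sum_next_generation.
by apply: eq_bigr => x _; rewrite -big_mkcond sum1_count.
Qed.

Lemma quadrant_count_sum p m c :
  quadrant_count p m c = \sum_(x <- level p) ((m <= x.1) && (c <= x.2)).
Proof.
rewrite /quadrant_count -sum1_count big_mkcond.
by apply: eq_bigr => x _ /=; case: ifP.
Qed.

Lemma count_iota_geq (R : pred nat) c n :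
  count (fun a => R a && (c <= a)) (iota 1 n) =
  count (fun a => R a && (c.+1 <= a)) (iota 1 n) + (R c && (1 <= c <= n)).
Proof.
elim: n => [|n IHn]; first by case: (R c) => /=; lia.
have -> : iota 1 n.+1 = iota 1 n ++ [:: n.+1].
  by rewrite -(addn1 n) iotaD add1n addn1.
rewrite !count_cat IHn /=.
case: (ltngtP c n.+1) => [ltcn|ltnc|->]; case: (R c); case: (R n.+1); try lia.
Qed.

(** The first component of a child (c, c) is at most m, so among the children
    with first component above m those labelled c are the (M + 1, c), one for
    each node (M, d) with m <= M and c <= d. *)
Lemma quadrant_count_offdiag p m c : 1 <= c <= m ->
  quadrant_count p.+1 m.+1 c =
  quadrant_count p.+1 m.+1 c.+1 + quadrant_count p m c.
Proof.
move=> c_ok; rewrite /quadrant_count !count_level -/(quadrant_count p m c).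
rewrite quadrant_count_sum -big_split /=.
apply: eq_big_seq => -[M d] /level_bounds /= dM; rewrite !count_map.
transitivity (count (fun a => (m < (if a <= d then M.+1 else a)) && (c <= a))
  (iota 1 M.+1)); first by [].
rewrite count_iota_geq; congr (_ + _).
by congr nat_of_bool; case: (leqP c d); lia.
Qed.

(** On the diagonal only the second component matters, because the first one is
    at least as large; every node with c <= M + 1 has exactly one child
    labelled c. *)
Lemma quadrant_count_diag p c : 1 <= c ->
  quadrant_count p.+1 c c =
  quadrant_count p.+1 c.+1 c.+1 + quadrant_count p c.-1 1.
Proof.
move=> c_gt0; rewrite /quadrant_count !count_level -/(quadrant_count p c.-1 1).
rewrite quadrant_count_sum -big_split /=.
apply: eq_big_seq => -[M d] /level_bounds /= dM; rewrite !count_map.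
have count_geq e : count (preim (fun a => (if a <= d then M.+1 else a, a))
    [pred x | (e <= x.1) && (e <= x.2)]) (iota 1 M.+1) =
  count (fun a => true && (e <= a)) (iota 1 M.+1).
  by apply: eq_count => a /=; case: (leqP a d); lia.
rewrite [LHS]count_geq count_iota_geq -count_geq; congr (_ + _).
by congr nat_of_bool; lia.
Qed.

(** Diagonal entries are indexed by b = p + 1 - m, which the Pascal rule
    preserves, and by q = m - 1. *)
Definition diagonal_count (b q : nat) := quadrant_count (b + q) q.+1 q.+1.

(** Iterating the Pascal rule i times expands an entry over the last diagonal
    entries of its line. *)
Lemma quadrant_count_binomial b q i : i <= q ->
  quadrant_count (b + q) q.+1 (q.+1 - i) =
  \sum_(j < i.+1) 'C(i, j) * diagonal_count b (q - j).
Proof.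
elim: i q => [|i IHi] q iq; first by rewrite big_ord1 subn0 mul1n subn0.
case: q iq => [//|q iq].
rewrite addnS quadrant_count_offdiag; last by lia.
have -> : (q.+2 - i.+1).+1 = q.+2 - i by lia.
rewrite -addnS IHi; last by lia.
rewrite subSS IHi //.
rewrite [RHS]big_ord_recl bin0 [in LHS]big_ord_recl bin0 -addnA; congr (_ + _).
rewrite [in RHS]big_ord_recr /= [X in _ + X = _]big_ord_recr /=.
rewrite !binn subSS addnA; congr (_ + _).
rewrite -big_split /=; apply: eq_bigr => j _.
by rewrite /bump /= !add1n binS mulnDl subSS.
Qed.

Lemma quadrant_count_all b q :
  quadrant_count (b + q) q.+1 1 = \sum_(j < q.+1) 'C(q, j) * diagonal_count b j.
Proof.
have -> : 1 = q.+1 - q by lia.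
rewrite quadrant_count_binomial // (reindex_inj rev_ord_inj) /=.
apply: eq_bigr => j _; rewrite subSS bin_sub ?leq_ord //.
by rewrite subKn // leq_ord.
Qed.

(** The first component grows by at most one per level. *)
Lemma quadrant_count_gt p m c : p.+1 < c -> quadrant_count p m c = 0.
Proof.
move=> c_gt; apply/eqP; rewrite -leqn0 leqNgt -has_count; apply/hasP=> -[x].
suff x_le : forall x, x \in level p -> x.1 <= p.+1.
  move=> x_in /=; move: (x_le _ x_in) (level_bounds x_in).
  by case: x {x_in} => M d /= ? ?; lia.
elim: {c c_gt x} p => [|p IHp] x; first by rewrite inE => /eqP->.
move=> /flattenP[_ /mapP[[M d] /IHp /= M_le ->]] /mapP[a].
by rewrite mem_iota /= => a_ok -> /=; case: (leqP a d); lia.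
Qed.

(** The recurrences of the diagonal entries: the last term of the diagonal rule
    is an entry with c = 1, hence a full binomial transform. *)
Lemma diagonal_count0S q :
  diagonal_count 0 q.+1 = \sum_(j < q.+1) 'C(q, j) * diagonal_count 0 j.
Proof.
rewrite -quadrant_count_all /diagonal_count !add0n quadrant_count_diag //.
by rewrite quadrant_count_gt.
Qed.

Lemma quadrant_count_le1 p : quadrant_count p 0 1 = quadrant_count p 1 1.
Proof.
by apply: eq_in_count => x /level_bounds /=; lia.
Qed.

Lemma diagonal_countS0 b :
  diagonal_count b.+1 0 = diagonal_count b 1 + diagonal_count b 0.
Proof.
rewrite /diagonal_count addn0 quadrant_count_diag //.
by rewrite addn1 quadrant_count_le1 addn0.
Qed.

Lemma diagonal_countSS b q :
  diagonal_count b.+1 q.+1 =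
  diagonal_count b q.+2 + \sum_(j < q.+1) 'C(q, j) * diagonal_count b.+1 j.
Proof.
rewrite -quadrant_count_all /diagonal_count addnS quadrant_count_diag //.
by rewrite !addnS !addSn.
Qed.

(** Stirling numbers of the second kind. *)
Fixpoint stirling (n k : nat) : nat :=
  match n, k with
  | 0, 0 => 1
  | 0, _.+1 => 0
  | _.+1, 0 => 0
  | m.+1, l.+1 => k * stirling m k + stirling m l
  end.

Lemma stirlingS n k :
  stirling n.+1 k.+1 = k.+1 * stirling n k.+1 + stirling n k.
Proof. by []. Qed.

Lemma stirlingS0 n : stirling n.+1 0 = 0. Proof. by []. Qed.

Lemma stirling_small n k : n < k -> stirling n k = 0.
Proof. by elim: n k => [|n IHn] [|k] //= nk; rewrite !IHn; lia. Qed.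

(** Choose the elements that do not share the block of the last one. *)
Lemma stirling_binomial n k :
  stirling n.+1 k.+1 = \sum_(j < n.+1) 'C(n, j) * stirling j k.
Proof.
elim: n k => [|n IHn] k; first by rewrite big_ord1 /= muln0 mul1n.
have binomS (F : nat -> nat) : \sum_(j < n.+2) 'C(n.+1, j) * F j =
    \sum_(j < n.+1) 'C(n, j) * (F j + F j.+1).
  rewrite big_ord_recl bin0 mul1n.
  under eq_bigr => j _ do rewrite lift0 binS mulnDl.
  under [RHS]eq_bigr => j _ do rewrite mulnDr.
  rewrite !big_split /= addnA; congr (_ + _).
  rewrite [in LHS]big_ord_recr /= bin_small // mul0n addn0.
  by rewrite [in RHS]big_ord_recl bin0 mul1n.
rewrite (binomS (stirling^~ k)); under eq_bigr => j _ do rewrite mulnDr.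
rewrite big_split -IHn stirlingS.
case: k => [|k].
  rewrite mul1n stirlingS0; congr (_ + _).
  by rewrite big1 // => j _; rewrite muln0.
under [X in _ = _ + X]eq_bigr => j _ do rewrite stirlingS mulnDr mulnCA.
by rewrite big_split -big_distrr -!IHn /=; lia.
Qed.

Definition pcat_tail (n k : nat) : nat := \sum_(k <= j < n.+1) pcat_coef n j.

(** The recurrence of the powered Catalan triangle, written for its tail sums
    only. *)
Lemma pcat_tail_rec n k :
  pcat_tail n.+1 k.+1 =
  pcat_tail n k + k * pcat_tail n k.+1 + pcat_tail n.+1 k.+2.
Proof.
rewrite /pcat_tail; case: (leqP k.+1 n.+1) => kn; last by rewrite !big_geq; lia.
rewrite big_ltn //= [\sum_(k <= j < n.+1) _]big_ltn //.
rewrite -/(pcat_coef _ _) mulSn; lia.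
Qed.

Lemma pcat_tail_diag n : pcat_tail n n = 1.
Proof.
rewrite /pcat_tail big_nat1; elim: n => //= n ->.
by rewrite big_geq // muln0.
Qed.

Lemma sum_stirlingS q N (F : nat -> nat) :
  \sum_(k < N.+1) stirling q.+1 k * F k =
  \sum_(k < N) stirling q.+1 k.+1 * F k.+1.
Proof. by rewrite big_ord_recl mul0n. Qed.

Lemma sum_stirling0 N (F : nat -> nat) :
  \sum_(k < N.+1) stirling 0 k * F k = F 0.
Proof. by rewrite big_ord_recl mul1n big1 ?addn0. Qed.

(** Summation by parts: the operator F k |-> k * F k + F (k + 1) is adjoint to
    the recurrence of the Stirling numbers. *)
Lemma sum_stirlingSS q N (F : nat -> nat) : q < N ->
  \sum_(k < N.+1) stirling q.+1 k * F k =
  \sum_(k < N) stirling q k * (k * F k + F k.+1).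
Proof.
move=> qN; rewrite sum_stirlingS.
under [RHS]eq_bigr => k _ do rewrite mulnDr mulnCA mulnA.
under [LHS]eq_bigr => k _ do rewrite stirlingS mulnDl.
rewrite !big_split /=; congr (_ + _).
case: N qN => // N qN.
rewrite big_ord_recr /= (stirling_small qN) muln0 addn0.
by rewrite [RHS]big_ord_recl mul0n add0n.
Qed.

Lemma sum_diagonal_binomial b q N :
    (forall j, j <= q -> diagonal_count b j =
       \sum_(k < N) stirling j k * pcat_tail (b + k).+1 k.+1) ->
  \sum_(j < q.+1) 'C(q, j) * diagonal_count b j =
  \sum_(k < N.+1) stirling q.+1 k * pcat_tail (b + k) k.
Proof.
move=> diagonalE.
under eq_bigr => j _ do rewrite diagonalE ?leq_ord // big_distrr.
rewrite exchange_big (sum_stirlingS _ _ (fun k => pcat_tail (b + k) k)).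
apply: eq_bigr => k _.
rewrite stirling_binomial big_distrl addnS; apply: eq_bigr => j _.
by rewrite /= mulnA.
Qed.

(** For b > 0 the recurrences of the diagonal entries become the recurrence of
    the tail sums, weighted by Stirling numbers. For b = 0 the tail sums that
    occur are all equal to 1, and the claim is the recurrence of the Bell
    numbers. The bound N on k is arbitrary, because terms with k > q vanish;
    this lets the sums be aligned. *)
Lemma diagonal_count_stirling b q N : q < N ->
  diagonal_count b q = \sum_(k < N) stirling q k * pcat_tail (b + k).+1 k.+1.
Proof.
elim: b q N => [|b IHb] q N.
  elim/ltn_ind: q N => -[|q] IHq [//|N] qN.
    rewrite (sum_stirling0 _ (fun k => pcat_tail (0 + k).+1 k.+1)).
    by rewrite pcat_tail_diag.
  rewrite diagonal_count0S.
  rewrite (@sum_diagonal_binomial _ _ N) => [|j jq]; last first.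
    by apply: IHq; lia.
  by apply: eq_bigr => k _; rewrite !pcat_tail_diag.
elim/ltn_ind: q N => -[|q] IHq [//|N] qN.
  rewrite (sum_stirling0 _ (fun k => pcat_tail (b.+1 + k).+1 k.+1)) addn0.
  rewrite diagonal_countS0 (IHb 1 2) // (IHb 0 1) // !big_ord_recl !big_ord0 /=.
  rewrite /bump /= !addn0 !muln0 !mul1n mul0n !add0n addn1.
  rewrite [RHS]pcat_tail_rec mul0n addn0 addnC.
  by congr (_ + _); rewrite /pcat_tail [in RHS]big_ltn.
rewrite diagonal_countSS (@sum_diagonal_binomial _ _ N) => [|j jq]; last first.
  by apply: IHq; lia.
rewrite (IHb _ N.+2) //.
rewrite (sum_stirlingSS (fun k => pcat_tail (b + k).+1 k.+1)) //.
rewrite -big_split; apply: eq_bigr => k _.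
move: (stirling _ _) => c /=; rewrite -mulnDr; congr (c * _).
by rewrite addnS addSn [RHS]pcat_tail_rec; lia.
Qed.

Lemma size_level p : size (level p) = powered_catalan p.+1.
Proof.
have -> : size (level p) = diagonal_count p 0.
  rewrite /diagonal_count addn0 -count_predT.
  by apply: eq_in_count => x /level_bounds /=; lia.
rewrite (diagonal_count_stirling p (N := 1)) // big_ord1 mul1n addn0.
by rewrite /powered_catalan big_ltn.
Qed.

(** * Growing permutations by appending a last value *)

Definition top_of_1_23 n (s : 'S_n) (i : 'I_n) : bool :=
  [exists j : 'I_n, exists h : 'I_n,
     [&& j < h, i == h.+1 :> nat, s j < s h & s h < s i]].

(** The values that may be appended to s are those up to this bound; the default
    n is reached when s has no occurrence of 1-23. *)
Definition append_bound n (s : 'S_n) : nat :=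
  \big[minn/n]_(i | top_of_1_23 s i) s i.

(** A last value 0 is recorded as the bound itself: in both cases, every value
    that may be appended raises the bound by one. *)
Definition perm_state n (s : 'S_n.+1) : nat * nat :=
  (append_bound s, if s ord_max == 0 :> nat then append_bound s else s ord_max).

Lemma leq_append_bound n (s : 'S_n) a :
  (a <= append_bound s) =
  (a <= n) && [forall i, top_of_1_23 s i ==> (a <= s i)].
Proof.
have -> : (a <= append_bound s) =
    (a <= n) && \big[andb/true]_(i | top_of_1_23 s i) (a <= s i).
  rewrite /append_bound; elim/big_rec2: _ => [|i b m _ IH].
    by rewrite andbT.
  by rewrite leq_min IH andbCA.
by rewrite big_andE.
Qed.

Lemma AV_1_23_4_tops n (s : 'S_n) :
  (s \in AV_1_23_4 n) =
  [forall i, top_of_1_23 s i ==> [forall k : 'I_n, (i < k) ==> (s k <= s i)]].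
Proof.
rewrite inE; apply/idP/idP.
  move=> av; apply/forallP => i; apply/implyP => /existsP[j /existsP[h hyp]].
  apply/forallP => k; apply/implyP => ik.
  rewrite leqNgt; apply: contra av => ltk.
  apply/existsP; exists j; apply/existsP; exists h; apply/existsP; exists i.
  by apply/existsP; exists k; case/and4P: hyp => -> -> -> ->; rewrite ik ltk.
move=> /forallP av; apply/existsP => -[j /existsP[h /existsP[i /existsP[k]]]].
case/and5P=> jh ih ik jlth /andP[hi iltk].
have top_i : top_of_1_23 s i.
  by apply/existsP; exists j; apply/existsP; exists h; rewrite jh ih jlth hi.
by have /implyP/(_ top_i)/forallP/(_ k) := av i; rewrite ik leqNgt iltk.
Qed.

Definition append n (a : 'I_n.+2) (s : 'S_n.+1) : 'S_n.+2 :=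
  lift_perm ord_max a s.

Lemma append_max n (a : 'I_n.+2) (s : 'S_n.+1) : append a s ord_max = a.
Proof. exact: lift_perm_id. Qed.

Lemma append_lift n (a : 'I_n.+2) (s : 'S_n.+1) i :
  append a s (lift ord_max i) = lift a (s i).
Proof. exact: lift_perm_lift. Qed.

Lemma append_bij n :
  bijective (fun p : 'S_n.+1 * 'I_n.+2 => append p.2 p.1).
Proof.
apply: inj_card_bij; last by rewrite card_prod card_ord !card_Sn factS mulnC.
move=> [s a] [t b] /= eq_st.
have ab : a = b by rewrite -(append_max a s) eq_st append_max.
congr (_, _) => //; apply/permP => i.
by apply: (@lift_inj _ a); rewrite -append_lift eq_st -ab append_lift.
Qed.

Lemma exists_ord_lift n (P : pred 'I_n.+1) :
  [exists i, P i] = P ord_max || [exists i : 'I_n, P (lift ord_max i)].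
Proof.
apply/existsP/orP => [[i]|[|/existsP[i]]]; last 2 first.
- by exists ord_max.
- by exists (lift ord_max i).
case: (unliftP ord_max i) => [j ->|->]; last by left.
by right; apply/existsP; exists j.
Qed.

Lemma forall_ord_lift n (P : pred 'I_n.+1) :
  [forall i, P i] = P ord_max && [forall i : 'I_n, P (lift ord_max i)].
Proof.
apply/negb_inj; rewrite negb_and !negb_forall.
exact: (exists_ord_lift (fun i => ~~ P i)).
Qed.

Lemma lift_lt n (a : 'I_n.+1) (x y : 'I_n) : (lift a x < lift a y) = (x < y).
Proof. by rewrite /= /bump; lia. Qed.

Lemma top_of_1_23_append n (a : 'I_n.+2) (s : 'S_n.+1) i :
  top_of_1_23 (append a s) (lift ord_max i) = top_of_1_23 s i.
Proof.
rewrite /top_of_1_23 exists_ord_lift [X in X || _](_ : _ = false); last first.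
  apply/existsP => -[h /and4P[]]; have := ltn_ord h; rewrite /=; lia.
apply: eq_existsb => j; rewrite exists_ord_lift.
rewrite [X in X || _](_ : _ = false); last first.
  apply/and4P => -[_]; rewrite lift_max; have := ltn_ord i; rewrite /=; lia.
by apply: eq_existsb => h; rewrite !append_lift !lift_lt !lift_max.
Qed.

(** The new entry ends an occurrence of 1-23 when it makes an ascent with a
    predecessor that is not the minimum: the minimum 0 then plays the role
    of 1. *)
Lemma top_of_1_23_append_max n (a : 'I_n.+2) (s : 'S_n.+1) :
  top_of_1_23 (append a s) ord_max = (0 < s ord_max < a).
Proof.
apply/existsP/andP => [[j /existsP[h /and4P[]]]|[s_gt0 s_lta]].
  case: (unliftP ord_max h) => [{}h ->|->] /=; last by lia.
  case: (unliftP ord_max j) => [{}j ->|->]; last first.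
    by have := ltn_ord h; rewrite /= /bump; lia.
  rewrite append_max !append_lift lift_lt lift_max => _ /eqP[nh] sj.
  have h_max : h = ord_max.
    by apply: val_inj; move: nh (ltn_ord h); rewrite /= /bump; lia.
  rewrite h_max in sj *.
  by move=> lift_lta; split; move: sj lift_lta; rewrite /= /bump; lia.
(* The minimum serves as the 1 of the pattern. *)
pose j := (s^-1)%g ord0; have sj : s j = ord0 by rewrite permKV.
exists (lift ord_max j); apply/existsP; exists (lift ord_max ord_max).
rewrite append_max !append_lift !lift_lt !lift_max sj /= eqxx s_gt0 /=.
have j_neq : j != ord_max by apply: contraTneq s_gt0 => <-; rewrite sj.
have -> : j < n by rewrite ltn_neqAle j_neq leq_ord.
by rewrite /bump; lia.
Qed.

(** A new occurrence of 1-23-4 must use the appended value as its 4. *)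
Lemma AV_1_23_4_append n (a : 'I_n.+2) (s : 'S_n.+1) :
  (append a s \in AV_1_23_4 n.+2) =
  (s \in AV_1_23_4 n.+1) && (a <= append_bound s).
Proof.
have a_le : a <= n.+1 by rewrite leq_ord.
rewrite !AV_1_23_4_tops leq_append_bound a_le /= forall_ord_lift andbC.
rewrite [X in _ && X = _](_ : _ = true) ?andbT; last first.
  apply/implyP => _; apply/forallP => k; apply/implyP.
  by rewrite /= ltnNge leq_ord.
have later_le i : [forall k : 'I_n.+2, (lift ord_max i < k) ==>
      (append a s k <= append a s (lift ord_max i))] =
    (a <= s i) && [forall k : 'I_n.+1, (i < k) ==> (s k <= s i)].
  rewrite forall_ord_lift append_max append_lift lift_max ltn_ord /=.
  congr (_ && _); first by rewrite /bump; lia.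
  apply: eq_forallb => k; rewrite append_lift /=.
  by move: (ltn_ord i) (ltn_ord k); rewrite /bump; lia.
apply/forallP/andP => [av|[/forallP av /forallP lebound] i].
  by split; apply/forallP => i; have := av i;
    rewrite top_of_1_23_append later_le; case: (top_of_1_23 s i) => //= /andP[].
have := av i; have := lebound i; rewrite top_of_1_23_append later_le.
by case: (top_of_1_23 s i) => //= -> ->.
Qed.

Lemma append_bound_append n (a : 'I_n.+2) (s : 'S_n.+1) : a <= append_bound s ->
  append_bound (append a s) =
  if 0 < s ord_max < a then a : nat else (append_bound s).+1.
Proof.
move=> a_le.
suff boundE b : (b <= append_bound (append a s)) =
    (b <= if 0 < s ord_max < a then a : nat else (append_bound s).+1).
  by apply/eqP; rewrite eqn_leq -boundE leqnn /= boundE.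
rewrite leq_append_bound forall_ord_lift top_of_1_23_append_max append_max.
have -> : [forall i, top_of_1_23 (append a s) (lift ord_max i) ==>
      (b <= append a s (lift ord_max i))] =
    [forall i, top_of_1_23 s i ==> (b.-1 <= s i)].
  apply: eq_forallb => i; rewrite top_of_1_23_append.
  apply: implyb_id2l => top_i.
  move: a_le; rewrite leq_append_bound => /andP[_ /forallP/(_ i)].
  rewrite top_i /=.
  by rewrite append_lift /= /bump; lia.
have := leq_append_bound s b.-1; have := ltn_ord a; move: [forall i, _] => c.
by case: ifP => _; case: c; rewrite ?andbT ?andbF; lia.
Qed.

(** Appending 0 produces the child with the largest label, M + 1; the other
    values are their own labels. *)
Lemma perm_state_append n (a : 'I_n.+2) (s : 'S_n.+1) : a <= append_bound s ->
  perm_state (append a s) =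
  child (perm_state s) (if a == 0 :> nat then (append_bound s).+1 else a).
Proof.
move=> a_le; rewrite /perm_state /child /= append_max append_bound_append //.
case: (posnP a) => [->|a_gt0] /=.
  by rewrite ltn0 andbF if_same.
case: (posnP (s ord_max)) => [->|_] /=.
  by rewrite a_le.
by rewrite ltnNge; case: leqP.
Qed.

(** The induction deletes the last value and applies the hypothesis to the
    weight that sums F over the children of a node; this is why F is
    arbitrary. *)
Lemma sum_perm_state n (F : nat * nat -> nat) :
  \sum_(s in AV_1_23_4 n.+1) F (perm_state s) = \sum_(x <- level n) F x.
Proof.
elim: n F => [|n IHn] F.
  rewrite (big_pred1 1%g) => [|s].
    rewrite big_seq1 /perm_state perm1 /= /append_bound big_pred0 // => i.
    by apply/existsP => -[j /existsP[h]]; rewrite !ord1.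
  rewrite inE; apply/idP/eqP=> [_|->].
    by apply/permP=> i; rewrite !ord1.
  by apply/existsP => -[j /existsP[h /existsP[i /existsP[k]]]]; rewrite !ord1.
have -> : level n.+1 = next_generation (level n) by [].
rewrite sum_next_generation -IHn.
rewrite (reindex _ (onW_bij _ (append_bij n))) /=.
rewrite [RHS](eq_bigr (fun s => \sum_(a : 'I_n.+2 | a < (append_bound s).+1)
  F (perm_state (append a s)))) => [|s _].
  by rewrite pair_big_dep; apply: eq_bigl => p; rewrite AV_1_23_4_append ltnS.
have bound_le : append_bound s <= n.+1.
  have := leq_append_bound s (append_bound s).
  by rewrite leqnn => /esym/andP[].
rewrite [RHS](eq_bigr (fun a : 'I_n.+2 => F (child (perm_state s)
  (if a == 0 :> nat then (append_bound s).+1 else a)))) => [|a]; last first.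
  by rewrite ltnS => /perm_state_append->.
rewrite -(big_ord_widen _ (fun a => F (child (perm_state s)
  (if a == 0 then (append_bound s).+1 else a)))) // big_ord_recl big_map.
have -> : iota 1 (perm_state s).1.+1 = index_iota 1 (append_bound s).+2.
  by rewrite /index_iota subn1.
(* The value 0 comes first on one side and its label M + 1 last on the other. *)
by rewrite big_nat_recr //= big_add1 big_mkord addnC.
Qed.

Lemma card_AV_1_23_4 n : #|AV_1_23_4 n.+1| = size (level n).
Proof. by rewrite -sum1_card (sum_perm_state n (fun=> 1)) sum1_size. Qed.

(** * Steady paths as sequences of drifts *)

Definition ups (Q : seq Defs.point) : nat := count_mem stepU Q.

(** Half of the difference x - y at the end of the path, which measures how far
    below the line y = x it lies; steps U leave it unchanged. *)
Definition drift (Q : seq Defs.point) : int :=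
  ((count_mem stepD Q)%:Z - (count_mem stepW Q)%:Z)%R.

Arguments ups : simpl never.
Arguments drift : simpl never.

Definition letters (Q : seq Defs.point) := all [in [:: stepU; stepD; stepW]] Q.

Lemma lettersP x :
  x \in [:: stepU; stepD; stepW] -> [\/ x = stepU, x = stepD | x = stepW].
Proof.
rewrite !inE => /or3P[/eqP|/eqP|/eqP];
  by [constructor 1 | constructor 2 | constructor 3].
Qed.

Lemma ups_cons x Q : ups (x :: Q) = (x == stepU) + ups Q.
Proof. by []. Qed.

Lemma drift_nil : drift [::] = 0%R. Proof. by []. Qed.
Lemma driftU Q : drift (stepU :: Q) = drift Q. Proof. by []. Qed.
Lemma driftD Q : drift (stepD :: Q) = (1 + drift Q)%R.
Proof. by rewrite /drift /=; lia. Qed.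
Lemma driftW Q : drift (stepW :: Q) = (drift Q - 1)%R.
Proof. by rewrite /drift /=; lia. Qed.
Lemma drift_cat Q R : drift (Q ++ R) = (drift Q + drift R)%R.
Proof. by rewrite /drift !count_cat; lia. Qed.

Lemma endpointE Q : letters Q ->
  endpoint Q = ((ups Q)%:Z + drift Q, (ups Q)%:Z - drift Q)%R.
Proof.
elim: Q => [|x Q IHQ]; first by rewrite /endpoint big_nil.
move=> /andP[/lettersP x_in /IHQ IH].
rewrite /endpoint big_cons -/(endpoint Q) IH.
by case: x_in => ->; rewrite ups_cons ?driftU ?driftD ?driftW;
  apply/eqP; rewrite xpair_eqE /=; apply/andP; split; apply/eqP => /=; lia.
Qed.

(** What is left to check of a steady path after a prefix that ends with the
    step prev, has p steps U, drift d, and confines the remaining drifts above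
    L. Both kinds of lines are covered by the last field: past a step U preceded
    by U or W, the drift relative to that step stays nonnegative. *)
Record steady_suffix (n : nat) (prev : Defs.point) (p L d : nat)
    (Q : seq Defs.point) : Prop := SteadySuffix {
  suffix_letters : letters Q;
  suffix_bounds : forall k, (L%:Z <= d%:Z + drift (take k Q) <=
                             p%:Z + (ups (take k Q))%:Z)%R;
  suffix_noWD : ~~ infix [:: stepW; stepD] (prev :: Q);
  suffix_noDW : ~~ infix [:: stepD; stepW] (prev :: Q);
  suffix_ups : p + ups Q = n;
  suffix_drift : (d%:Z + drift Q = n%:Z)%R;
  suffix_lines : forall A x B, prev :: Q = A ++ [:: x; stepU] ++ B ->
    x != stepD -> forall k, (0 <= drift (take k B))%R }.

(** One bound L remembers all the lines met so far: the drift never goes below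
    it, so the line through a new step U after U or W, which lies at the current
    drift, supersedes the earlier ones. *)
Fixpoint accepts (n : nat) (prev : Defs.point) (p L d : nat)
    (Q : seq Defs.point) : Prop :=
  match Q with
  | [::] => p = n /\ d = n
  | x :: Q' =>
    [\/ x = stepU /\ accepts n stepU p.+1 (if prev == stepD then L else d) d Q',
        [/\ x = stepD, prev != stepW, d < p & accepts n stepD p L d.+1 Q'] |
        [/\ x = stepW, prev != stepD, L < d & accepts n stepW p L d.-1 Q']]
  end.

Lemma infix2_cons (a b x y : Defs.point) Q :
  infix [:: a; b] (x :: y :: Q) =
  (a == x) && (b == y) || infix [:: a; b] (y :: Q).
Proof. by rewrite /= prefix0s andbT. Qed.

Lemma lines_cons prev x Q :
  (forall A y B, [:: prev, x & Q] = A ++ [:: y; stepU] ++ B ->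
    y != stepD -> forall k, (0 <= drift (take k B))%R) <->
  (x = stepU -> prev != stepD -> forall k, (0 <= drift (take k Q))%R) /\
  (forall A y B, x :: Q = A ++ [:: y; stepU] ++ B ->
    y != stepD -> forall k, (0 <= drift (take k B))%R).
Proof.
split=> [lines|[line0 lines] [|z A] y B].
- split=> [xU|A y B eQ]; first by apply: (lines [::]); rewrite xU.
  by apply: (lines (prev :: A)); rewrite eQ.
- by move=> [<- xU <-] yD; apply: line0.
by move=> [_ eQ]; apply: lines eQ.
Qed.

Lemma steady_suffixP n prev p L d Q : L <= d <= p ->
  steady_suffix n prev p L d Q <-> accepts n prev p L d Q.
Proof.
elim: Q prev p L d => [|x Q IHQ] prev p L d Ldp.
  split=> [[_ _ _ _]|/= [pn dn]]; first by rewrite /ups /drift /=; lia.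
  split=> //.
  - by move=> k; rewrite /ups /drift /=; lia.
  - by rewrite /= andbF.
  - by rewrite /= andbF.
  - by rewrite /ups /=; lia.
  - by rewrite /drift /=; lia.
  by move=> [|? [|? A]] ? ? [].
split.
  case=> /andP[/lettersP x_in Q_ok] bds.
  rewrite infix2_cons negb_or => /andP[WD noWD].
  rewrite infix2_cons negb_or => /andP[DW noDW].
  move=> ups_n drift_n /lines_cons[line0 lines].
  case: x_in => ex; subst x.
  - constructor 1; split=> //; apply/IHQ; first by case: ifP; lia.
    split=> //.
    + move=> k; move: (bds k.+1) => /=; rewrite ups_cons driftU.
      by case: eqP line0 => [_ _|_ /(_ erefl isT k)]; rewrite ?eqxx; lia.
    + by move: ups_n; rewrite ups_cons eqxx; lia.
  - have := bds 1; rewrite /= take0 => bd1.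
    have d_lt : d < p by move: bd1; rewrite /ups /drift /=; lia.
    constructor 2; split=> //; first by move: WD; rewrite eqxx andbT eq_sym.
    apply/IHQ; first by lia.
    split=> //.
    + by move=> k; move: (bds k.+1) => /=; rewrite ups_cons driftD /=; lia.
    + by move: drift_n; rewrite driftD; lia.
  have := bds 1; rewrite /= take0 => bd1.
  have L_lt : L < d by move: bd1; rewrite /ups /drift /=; lia.
  constructor 3; split=> //; first by move: DW; rewrite eqxx andbT eq_sym.
  apply/IHQ; first by lia.
  split=> //.
  + by move=> k; move: (bds k.+1) => /=; rewrite ups_cons driftW /=; lia.
  + by move: drift_n; rewrite driftW; lia.
case=> [[-> acc]|[-> pW dp acc]|[-> pD Ld acc]].
- have [|Q_ok bds noWD noDW ups_n drift_n lines] := (IHQ _ _ _ _ _).2 acc.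
    by case: ifP; lia.
  split=> //.
  + move=> [|k]; first by rewrite /ups /drift /=; lia.
    rewrite /= ups_cons driftU; move: (bds k); case: ifP; rewrite ?eqxx; lia.
  + by rewrite infix2_cons negb_or noWD andbF.
  + by rewrite infix2_cons negb_or noDW andbF.
  + by rewrite ups_cons eqxx; lia.
  apply/lines_cons; split=> // _ prev_D k.
  by move: (bds k); rewrite (negPf prev_D); lia.
- have [|Q_ok bds noWD noDW ups_n drift_n lines] := (IHQ _ _ _ _ _).2 acc.
    by lia.
  split=> //.
  + move=> [|k]; first by rewrite /ups /drift /=; lia.
    by rewrite /= ups_cons driftD; move: (bds k) => /=; lia.
  + by rewrite infix2_cons negb_or noWD eq_sym negb_and pW.
  + by rewrite infix2_cons negb_or noDW andbF.
  + by rewrite driftD; lia.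
  by apply/lines_cons.
have [|Q_ok bds noWD noDW ups_n drift_n lines] := (IHQ _ _ _ _ _).2 acc.
  by lia.
split=> //.
+ move=> [|k]; first by rewrite /ups /drift /=; lia.
  by rewrite /= ups_cons driftW; move: (bds k) => /=; lia.
+ by rewrite infix2_cons negb_or noWD andbF.
+ by rewrite infix2_cons negb_or noDW eq_sym negb_and pD.
+ by rewrite driftW; lia.
by apply/lines_cons.
Qed.

Lemma in_coneE Q : letters Q ->
  in_cone (endpoint Q) <-> (0 <= drift Q <= (ups Q)%:Z)%R.
Proof.
move=> /endpointE ->; rewrite /in_cone /=.
by split=> [[]|]; [lia | split; lia].
Qed.

Lemma weakly_belowE A B : letters A -> letters B ->
  weakly_below (endpoint A) (endpoint B) <-> (drift A <= drift B)%R.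
Proof.
by move=> /endpointE -> /endpointE ->; rewrite /weakly_below /=; lia.
Qed.

Lemma letters_cat Q R : letters (Q ++ R) = letters Q && letters R.
Proof. exact: all_cat. Qed.

Lemma letters_take k Q : letters Q -> letters (take k Q).
Proof. by rewrite -{1}(cat_take_drop k Q) letters_cat => /andP[]. Qed.

(** Pretending that a step U precedes the path adds no constraint: the bound 0
    it would impose on the drift is already part of the cone condition. *)
Lemma steady_pathP n P : steady_path n P <-> accepts n stepU 0 0 0 P.
Proof.
rewrite -steady_suffixP //; split.
  case=> P_ok cone noWD noDW Pend UU WU.
  have bds k : (0 <= drift (take k P) <= (ups (take k P))%:Z)%R.
    by apply/in_coneE; [exact: letters_take | exact: cone].
  move: Pend; rewrite endpointE // => -[X Y].
  split=> //.
  - by move=> k; move: (bds k); lia.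
  - by lia.
  - by lia.
  move=> [|z A] x B.
    by move=> [_ eP] _ k; move: (bds k.+1); rewrite eP /= driftU; lia.
  move=> [_ eP] xD k; subst P.
  have : letters (A ++ [:: x; stepU] ++ B) := P_ok.
  rewrite !letters_cat => /and3P[A_ok x_ok B_ok].
  have kB_ok : letters (take k B) by apply: letters_take.
  have [xU|xW] : x = stepU \/ x = stepW.
    by case/andP: x_ok => /lettersP[] xE; [left | rewrite xE in xD | right].
    subst x; have := UU A B erefl k; rewrite weakly_belowE //; last first.
      by rewrite !letters_cat A_ok kB_ok.
    by rewrite !drift_cat !driftU drift_nil; lia.
  subst x; have := WU A B erefl k; rewrite weakly_belowE; first last.
  - by rewrite !letters_cat A_ok kB_ok.
  - by rewrite !letters_cat A_ok.
  by rewrite !drift_cat !driftW !driftU drift_nil; lia.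
case=> P_ok bds noWD noDW ups_n drift_n lines.
split=> //.
- by move=> k; apply/in_coneE; [exact: letters_take | move: (bds k); lia].
- by rewrite endpointE //; congr (_, _); lia.
- move=> A B eP k; subst P.
  move: P_ok; rewrite !letters_cat => /and3P[A_ok _ B_ok].
  have kB_ok : letters (take k B) by apply: letters_take.
  rewrite weakly_belowE ?letters_cat ?A_ok ?kB_ok //.
  rewrite !drift_cat !driftU drift_nil.
  by have := lines (stepU :: A) stepU B erefl isT k; lia.
move=> A B eP k; subst P.
move: P_ok; rewrite !letters_cat => /and3P[A_ok _ B_ok].
have kB_ok : letters (take k B) by apply: letters_take.
rewrite weakly_belowE ?letters_cat ?A_ok ?kB_ok //.
rewrite !drift_cat !driftW !driftU drift_nil.
by have := lines (stepU :: A) stepW B erefl isT k; lia.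
Qed.

(** The steps that lead from drift d to drift b between two steps U. *)
Definition run (d b : nat) : seq Defs.point :=
  if d <= b then nseq (b - d) stepD else nseq (d - b) stepW.

Definition run_ended (n p L b : nat) (Q : seq Defs.point) : Prop :=
  match Q with
  | [::] => p = n /\ b = n
  | x :: Q' => x = stepU /\ accepts n stepU p.+1 L b Q'
  end.

Lemma accepts_after_D n p L d Q : d <= p ->
  accepts n stepD p L d Q <->
  exists m Q', [/\ Q = nseq m stepD ++ Q', d + m <= p &
                   run_ended n p L (d + m) Q'].
Proof.
elim: Q d => [|x Q IHQ] d dp.
  split=> [acc|[[|m] [[|? ?] [] //]]].
    by exists 0, [::]; rewrite addn0.
  by rewrite addn0.
split=> [[[-> acc]|[-> _ d_lt /IHQ]|[_ //]]|].
- by exists 0, (stepU :: Q); rewrite addn0.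
- case=> // m [Q' [-> dm st]]; exists m.+1, Q'; rewrite addnS -addSn.
  by split.
move=> [[|m] [Q' []]].
  rewrite addn0 => /= <- _ [-> acc]; by constructor 1.
move=> [-> eQ] dm st; constructor 2; split=> //; first by lia.
by apply/IHQ; [lia | exists m, Q'; rewrite eQ addSnnS].
Qed.

Lemma accepts_after_W n p L d Q : L <= d ->
  accepts n stepW p L d Q <->
  exists m Q', [/\ Q = nseq m stepW ++ Q', L + m <= d &
                   run_ended n p (d - m) (d - m) Q'].
Proof.
elim: Q d => [|x Q IHQ] d Ld.
  split=> [acc|[[|m] [[|? ?] [] //]]].
    by exists 0, [::]; rewrite addn0 subn0.
  by rewrite subn0.
split=> [[[-> acc]|[_ //]|[-> _ d_lt /IHQ]]|].
- by exists 0, (stepU :: Q); rewrite addn0 subn0.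
- case=> [|m [Q' [-> dm st]]]; first by lia.
  exists m.+1, Q'; split=> //; first by lia.
  by have -> : d - m.+1 = d.-1 - m by lia.
move=> [[|m] [Q' []]].
  rewrite subn0 => /= <- _ [-> acc]; by constructor 1.
move=> [-> eQ] dm st; constructor 3; split=> //; first by lia.
apply/IHQ; [lia | exists m, Q'; split=> //; first by lia].
by have -> : d.-1 - m = d - m.+1 by lia.
Qed.

(** A run that ends at or below its starting drift is empty or made of steps W,
    so the next step U raises the bound to b; after steps D the bound stays. *)
Lemma accepts_after_U n p L d Q : L <= d <= p ->
  accepts n stepU p L d Q <->
  exists b Q', [/\ Q = run d b ++ Q', L <= b <= p &
                   run_ended n p (if b <= d then b else L) b Q'].
Proof.
move=> Ldp; split.
  case: Q => [acc|x Q [[-> acc]|[-> _ d_lt after_D]|[-> _ d_lt after_W]]].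
  - by exists d, [::]; rewrite /run leqnn subnn.
  - by exists d, (stepU :: Q); rewrite /run leqnn subnn.
  - have /accepts_after_D[] // := after_D.
    move=> m [Q' [-> dm st]]; exists (d.+1 + m), Q'; split.
    + rewrite /run ifT; last by lia.
      by have -> : d.+1 + m - d = m.+1 by lia.
    + by lia.
    by rewrite ifF //; lia.
  have /accepts_after_W[|m [Q' [-> dm st]]] := after_W; first by lia.
  exists (d.-1 - m), Q'; split.
  - rewrite /run ifF; last by lia.
    by have -> : d - (d.-1 - m) = m.+1 by lia.
  - by lia.
  by rewrite ifT //; lia.
move=> [b [Q' [-> Lbp]]]; rewrite /run.
case: (ltngtP d b) => [d_lt|b_lt|<-] st.
- have -> : b - d = (b - d.+1).+1 by lia.
  constructor 2; split=> //; first by lia.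
  apply/accepts_after_D; [lia | exists (b - d.+1), Q'].
  by have -> : d.+1 + (b - d.+1) = b; [lia | split=> //; lia].
- have -> : d - b = (d.-1 - b).+1 by lia.
  constructor 3; split=> //; first by lia.
  apply/accepts_after_W; [lia | exists (d.-1 - b), Q'].
  by have -> : d.-1 - (d.-1 - b) = b; [lia | split=> //; lia].
rewrite subnn /=; case: Q' st => [|x Q'] //= [-> acc].
by constructor 1.
Qed.

(** All suffixes with r further steps U, following a step U taken at drift d. At
    the last run the drift has to reach p, the final number of steps U. *)
Fixpoint steady_suffixes (r p L d : nat) : seq (seq Defs.point) :=
  if r is r'.+1 then
    [seq run d b ++ stepU :: Q |
      b <- iota L (p.+1 - L),
      Q <- steady_suffixes r' p.+1 (if b <= d then b else L) b]
  else [:: run d p].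

Lemma accepts_leq n prev p L d Q : accepts n prev p L d Q -> p <= n.
Proof.
elim: Q prev p L d => [|x Q IHQ] prev p L d /=; first by case=> ->.
by case=> [[_ /IHQ /ltnW]|[_ _ _ /IHQ]|[_ _ _ /IHQ]].
Qed.

Lemma mem_steady_suffixes r p L d Q : L <= d <= p ->
  Q \in steady_suffixes r p L d <-> accepts (p + r) stepU p L d Q.
Proof.
elim: r p L d Q => [|r IHr] p L d Q Ldp; rewrite accepts_after_U //.
  rewrite addn0 inE; split=> [/eqP->|[b [[|x Q'] [-> _]]]].
  - by exists p, [::]; rewrite cats0; split=> //; lia.
  - by move=> [_ ->]; rewrite cats0.
  by case=> _ /accepts_leq; rewrite ltnn.
split=> [/allpairsPdep[b [Q' []]]|[b [[|x Q'] [-> Lbp]]]].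
- rewrite mem_iota => Lbp /IHr acc ->; exists b, (stepU :: Q'); split=> //.
    by lia.
  by split=> //; rewrite addnS -addSn; apply: acc; case: ifP; lia.
- by case; lia.
case=> -> acc; apply/allpairsPdep; exists b, Q'; split=> //.
  by rewrite mem_iota; lia.
by apply/IHr; [case: ifP; lia | rewrite addSn -addnS].
Qed.

Lemma cat_cons_inj (T : eqType) (x : T) r1 r2 s1 s2 :
  x \notin r1 -> x \notin r2 -> r1 ++ x :: s1 = r2 ++ x :: s2 ->
  r1 = r2 /\ s1 = s2.
Proof.
elim: r1 r2 => [|y r1 IHr] [|z r2] //=; rewrite ?inE ?negb_or.
- by move=> _ _ [->].
- by move=> _ /andP[xz _] [eq_xz]; rewrite eq_xz eqxx in xz.
- by move=> /andP[xy _] _ [eq_xy]; rewrite eq_xy eqxx in xy.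
by move=> /andP[_ r1x] /andP[_ r2x] [-> /IHr[] // -> ->].
Qed.

Lemma stepU_notin_run d b : stepU \notin run d b.
Proof. by rewrite /run; case: ifP => _; rewrite mem_nseq andbF. Qed.

Lemma drift_run d b : drift (run d b) = (b%:Z - d%:Z)%R.
Proof.
have driftDs m : (drift (nseq m stepD) = m%:Z)%R.
  by elim: m => // m IHm; rewrite [nseq _ _]/= driftD IHm; lia.
have driftWs m : (drift (nseq m stepW) = - m%:Z)%R.
  by elim: m => // m IHm; rewrite [nseq _ _]/= driftW IHm; lia.
by rewrite /run; case: ifP => bd; rewrite ?driftDs ?driftWs; lia.
Qed.

(** The first step U delimits the first run, and the drift of this run
    determines the chosen value b. *)
Lemma steady_suffixes_uniq r p L d : uniq (steady_suffixes r p L d).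
Proof.
elim: r p L d => [|r IHr] p L d //=.
apply: allpairs_uniq_dep => [|b _|]; [exact: iota_uniq | exact: IHr |].
move=> [b Q] [b' Q'] _ _ /= /cat_cons_inj[].
1,2: exact: stepU_notin_run.
move=> eq_run ->.
by have := drift_run d b; rewrite eq_run drift_run => eq_b; congr existT; lia.
Qed.

Lemma sum_iota (F : nat -> nat) m k :
  \sum_(i <- iota m k) F i = \sum_(i < k) F (m + i).
Proof. by rewrite -{1}(addn0 m) iotaDl big_map -{1}(subn0 k) big_mkord. Qed.

(** The drift b in [L, p] corresponds to the child label a = p + 1 - b, so that
    the two enumerations run in opposite orders. *)
Lemma size_steady_suffixes r p L d : L <= d <= p ->
  size (steady_suffixes r p L d) = size (generation r [:: (p - L, p - d)]).
Proof.
elim: r p L d => [|r IHr] p L d Ldp //=.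
rewrite size_allpairs_dep sumnE big_map.
rewrite /generation -iterS iterSr -/(generation _ _) size_generation.
rewrite sum_next_generation big_seq1 big_map !sum_iota subSn; last by lia.
rewrite (reindex_inj rev_ord_inj) /=; apply: eq_bigr => i _.
rewrite IHr; last by have := ltn_ord i; case: ifP; lia.
rewrite /child; congr (size (generation r [:: (_, _)])); last first.
  by have := ltn_ord i; lia.
by have := ltn_ord i => /=; case: ifP; case: ifP; lia.
Qed.

Lemma card_seq_eq (T : choiceType) (A : set T) (s : seq T) :
  uniq s -> (forall x, A x <-> x \in s) -> (A #= `I_(size s))%card.
Proof.
move=> s_uniq As; rewrite (_ : A = [set` [fset x in s]%fset]%classic).
  by apply/card_eq_fsetP; rewrite card_fseq undup_id.
by apply/seteqP; split=> x /=; rewrite !inE => /As.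
Qed.

Local Open Scope classical_set_scope.

Theorem proposition29 (n : nat) (hn : (1 <= n)%N) :
  ([set P | steady_path n P] #= `I_#|AV_1_23_4 n|)%card /\
  ([set P | steady_path n P] #= `I_(powered_catalan n))%card.
Proof.
case: n hn => // n _; rewrite card_AV_1_23_4 size_level.
suff card_steady :
    ([set P | steady_path n.+1 P] #= `I_(powered_catalan n.+1))%card by [].
have -> : powered_catalan n.+1 =
    size [seq stepU :: Q | Q <- steady_suffixes n 1 0 0].
  by rewrite size_map size_steady_suffixes // -size_level.
apply: card_seq_eq => [|P].
  by rewrite map_inj_uniq ?steady_suffixes_uniq // => Q Q' [].
rewrite /= steady_pathP; split.
  case: P => [[]|x P] // [[-> acc]|[_ _] //|[_ _] //].
  by apply/map_f/mem_steady_suffixes.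
case/mapP=> Q /mem_steady_suffixes acc ->.
by constructor 1; split=> //; apply: acc.
Qed.
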